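(* Let $A$ be an alphabet with exactly three letters. Let $F\subset A^*$ be a uniformly recurrent set of words which contains $A$ and is a tree set (satisfies the tree condition). Then for every $x\in F$, the set $R_F(x)$ of first right return words to $x$ is a basis of the free group on $A$.
   Context: $A^*$ is the set of all words on $A$ (including the empty word), and $A^+$ the set of nonempty words. A set of words is factorial if it contains all factors of its elements. For $w\in F$ put $L(w)=\{a\in A\mid aw\in F\}$, $R(w)=\{a\in A\mid wa\in F\}$, $E(w)=\{(a,b)\in A\times A\mid awb\in F\}$. A factorial set $F$ is right-essential if $R(w)\neq\emptyset$ for every $w\in F$, and biessential if $E(w)\ne\emptyset$ for every $w\in F$. A set $F$ is uniformly recurrent if it is (factorial and) right-essential and for every $u\in F$ there is an integer $n\ge 1$ such that $u$ is a factor of every word of $F$ of length $n$. Tree set (tree condition): for a biessential set $F$ and $w\in F$, the extension graph $G(w)$ is the undirected bipartite graph whose vertex set is the disjoint union of $L(w)$ and $R(w)$ and whose edges are the pairs $(a,b)\in E(w)$ (joining $a$ in the copy of $L(w)$ to $b$ in the copy of $R(w)$). $F$ is a tree set if it is biessential and for every $w\in F$ (including the empty word) the graph $G(w)$ is a tree (connected and acyclic). For $x\in F$, $\Gamma_F(x)=\{r\in F\mid xr\in F\cap A^+x\}$ and $R_F(x)=\Gamma_F(x)\setminus \Gamma_F(x)A^+$ is the set of first right return words to $x$. *)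

(* Defs.v *)
From HB Require Import structures.
From mathcomp Require Import all_boot all_classical.

Set Implicit Arguments.
Unset Strict Implicit.
Unset Printing Implicit Defensive.

Local Open Scope classical_set_scope.

(* The free group on T is the set of reduced words over T and its formal
   inverses, (a, true) standing for a and (a, false) for a^-1. *)

Section FreeGroup.
Variable T : choiceType.
Implicit Types (x y : T * bool) (u v w : seq (T * bool)).

Definition linv x : T * bool := (x.1, ~~ x.2).

Definition reduced w : bool := sorted (fun x y => y != linv x) w.

Definition push x w :=
  if w is y :: w' then if y == linv x then w' else x :: w else [:: x].

Definition reduce w := foldr push [::] w.

Record freegroup := FreeGroup { fgval : seq (T * bool); _ : reduced fgval }.

HB.instance Definition _ := [isSub for fgval].
HB.instance Definition _ := [Choice of freegroup by <:].

Lemma linvK : involutive linv.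
Proof. by case=> a b; rewrite /linv /= negbK. Qed.

Lemma reduced_push x w : reduced w -> reduced (push x w).
Proof.
case: w => [//|y w] /=; case: eqP => [_ /path_sorted //|/eqP yx].
by rewrite /reduced /= yx.
Qed.

Lemma reduced_foldr u w : reduced w -> reduced (foldr push w u).
Proof. by move=> rw; elim: u => //= x u; exact: reduced_push. Qed.

Lemma reduced_reduce w : reduced (reduce w).
Proof. exact: reduced_foldr. Qed.

Lemma reduce_id w : reduced w -> reduce w = w.
Proof.
elim: w => //= x w IH rw; rewrite IH; last exact: path_sorted rw.
by case: w rw {IH} => //= y w /andP[/negPf->].
Qed.

Lemma pushK x w : reduced w -> push x (push (linv x) w) = w.
Proof.
case: w => [|y w] /=; first by rewrite eqxx.
rewrite linvK; case: eqP => [->|_] rw /=; last by rewrite eqxx.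
by case: w rw => //= z w /andP[/negPf->].
Qed.

Lemma foldr_push x u w : reduced w ->
  foldr push w (push x u) = push x (foldr push w u).
Proof.
move=> rw; case: u => //= y u; case: eqP => //= ->.
by rewrite pushK //; exact: reduced_foldr.
Qed.

Lemma foldr_reduce u w : reduced w -> foldr push w (reduce u) = foldr push w u.
Proof. by move=> rw; elim: u => //= x u <-; exact: foldr_push. Qed.

Lemma reduce_cat u w : reduce (u ++ w) = foldr push (reduce w) u.
Proof. exact: foldr_cat. Qed.

Lemma reduce_catl u w : reduce (reduce u ++ w) = reduce (u ++ w).
Proof. by rewrite !reduce_cat foldr_reduce ?reduced_reduce. Qed.

Lemma reduce_catr u w : reduce (u ++ reduce w) = reduce (u ++ w).
Proof. by rewrite !reduce_cat reduce_id ?reduced_reduce. Qed.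

Definition winv w := rev (map linv w).

Lemma winvK : involutive winv.
Proof. by move=> w; rewrite /winv map_rev revK mapK //; exact: linvK. Qed.

Lemma reduced_winv w : reduced w -> reduced (winv w).
Proof.
rewrite /reduced /winv rev_sorted sorted_map; apply: sub_sorted => x y /=.
by rewrite linvK; apply: contraNN => /eqP ->.
Qed.

Lemma reduce_winvr w : reduce (w ++ winv w) = [::].
Proof.
elim: w => //= x w IH; rewrite /winv map_cons rev_cons -cats1 catA.
rewrite -reduce_catl -/(winv w) IH /= eqxx //.
Qed.

Definition fg_one : freegroup := @FreeGroup [::] isT.
Definition fg_mul (g h : freegroup) : freegroup :=
  FreeGroup (reduced_reduce (fgval g ++ fgval h)).
Definition fg_inv (g : freegroup) : freegroup :=
  FreeGroup (reduced_winv (valP g)).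

Lemma fg_mulA : associative fg_mul.
Proof.
by move=> g h k; apply: val_inj; rewrite /= reduce_catl reduce_catr catA.
Qed.

Lemma fg_mul1g : left_id fg_one fg_mul.
Proof. by move=> g; apply: val_inj; rewrite /= reduce_id // (valP g). Qed.

Lemma fg_mulg1 : right_id fg_one fg_mul.
Proof. by move=> g; apply: val_inj; rewrite /= cats0 reduce_id // (valP g). Qed.

Lemma fg_mulgV : right_inverse fg_one fg_inv fg_mul.
Proof. by move=> g; apply: val_inj; rewrite /= reduce_winvr. Qed.

Lemma fg_mulVg : left_inverse fg_one fg_inv fg_mul.
Proof.
move=> g; apply: val_inj => /=.
by rewrite -{2}[fgval g]winvK reduce_winvr.
Qed.

HB.instance Definition _ := isGroup.Build freegroup
  fg_mulA fg_mul1g fg_mulg1 fg_mulVg fg_mulgV.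

Definition fg_gen (a : T) : freegroup := @FreeGroup [:: (a, true)] isT.

End FreeGroup.

(* The unique group morphism from the free group on T to G that extends f. *)
Definition fg_lift (T : choiceType) (G : groupType) (f : T -> G)
    (g : freegroup T) : G :=
  (\prod_(x <- fgval g) if x.2 then f x.1 else (f x.1)^-1)%g.

Section FreeGroupLift.
Variables (T : choiceType) (G : groupType) (f : T -> G).
Local Open Scope group_scope.

Let ev (w : seq (T * bool)) : G :=
  \prod_(x <- w) if x.2 then f x.1 else (f x.1)^-1.

Lemma fg_lift_gen a : fg_lift f (fg_gen a) = f a.
Proof. by rewrite /fg_lift big_seq1. Qed.

Lemma fg_lift1 : fg_lift f 1 = 1.
Proof. by rewrite /fg_lift big_nil. Qed.

Lemma fg_liftM : {morph fg_lift f : g h / g * h}.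
Proof.
have ev_push x w : ev (push x w) = ev (x :: w).
  case: w => //= y w; case: eqP => // ->; rewrite /ev !big_cons /=.
  by case: x => a [] /=; rewrite ?mulKg ?mulVKg.
have ev_reduce w : ev (reduce w) = ev w.
  by elim: w => //= x w IH; rewrite ev_push /ev !big_cons -!/(ev _) IH.
by move=> g h; rewrite /fg_lift -!/(ev _) ev_reduce /ev big_cat.
Qed.

HB.instance Definition _ := isUMagmaMorphism.Build (freegroup T) G (fg_lift f)
  (fg_lift1, fg_liftM).

End FreeGroupLift.

(* X is a basis of G when the canonical morphism from the free group on X to G
   is an isomorphism. *)
Definition is_basis (G : groupType) (X : set G) : Prop :=
  bijective (fg_lift (fun x : set_type X => val x : G)).

(* Graphs are given by a symmetric irreflexive adjacency relation on the type
   of vertices. A repetition-free closed walk with two vertices only goes back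
   and forth along one edge, so cycles are those with more than two vertices. *)

Definition graph_connected (V : eqType) (e : rel V) : Prop :=
  forall u v : V, exists2 p : seq V, path e u p & v = last u p.

Definition graph_acyclic (V : eqType) (e : rel V) : Prop :=
  forall c : seq V, ucycle e c -> size c <= 2.

Definition is_tree (V : eqType) (e : rel V) : Prop :=
  graph_connected e /\ graph_acyclic e.


Section Words.
Variable A : choiceType.
Implicit Types (F : set (seq A)) (u v w x r : seq A).

Definition factorial_set F : Prop := forall u v, F v -> infix u v -> F u.

Definition Lext F w : set A := [set a | F (a :: w)].
Definition Rext F w : set A := [set b | F (rcons w b)].
Definition Eext F w : set (A * A) := [set ab | F (ab.1 :: rcons w ab.2)].

Definition right_essential F : Prop :=
  factorial_set F /\ forall w, F w -> Rext F w !=set0.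

Definition biessential F : Prop :=
  factorial_set F /\ forall w, F w -> Eext F w !=set0.

Definition uniformly_recurrent F : Prop :=
  right_essential F /\
  forall u, F u -> exists2 n, 1 <= n & forall v, F v -> size v = n -> infix u v.

(* Disjoint union of L(w) and R(w); the summand keeps the two copies apart. *)
Definition ext_vertex F w : choiceType :=
  (set_type (Lext F w) + set_type (Rext F w))%type.

Definition ext_edge F w : rel (ext_vertex F w) := fun s t =>
  match s, t with
  | inl a, inr b | inr b, inl a => (val a, val b) \in Eext F w
  | _, _ => false
  end.

Definition tree_set F : Prop :=
  biessential F /\ forall w, F w -> is_tree (@ext_edge F w).

Definition word_plus : set (seq A) := [set w | w <> [::]].

Definition concat (U V : set (seq A)) : set (seq A) :=
  [set u ++ v | u in U & v in V].

Definition Gamma F x : set (seq A) :=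
  [set r | F r /\ (F `&` concat word_plus [set x]) (x ++ r)].

Definition first_right_return F x : set (seq A) :=
  Gamma F x `\` concat (Gamma F x) word_plus.

Definition fg_word w : freegroup A := (\prod_(a <- w) fg_gen a)%g.

End Words.

(* Main.v *)
Require Import Defs.
From mathcomp Require Import all_boot all_classical.

Set Implicit Arguments.
Unset Strict Implicit.
Unset Printing Implicit Defensive.

Local Open Scope classical_set_scope.
Local Open Scope group_scope.

(** Write R for the set of first right return words to x. Being a basis means
    that the morphism from the free group on R to the free group on A is onto
    and has a left inverse. The two halves use the two halves of the tree
    condition, and both follow the same descent.

    The descent concerns functions h of the long words of F. By recurrence,
    every long word contains x, so that a function that only depends on what
    follows an occurrence of x is determined by the last N letters of its
    argument, for some N. One then shows, for n decreasing from N to 0, that h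
    is determined by the last n letters. The passage from n + 1 to n takes place
    at each word w of length n separately: it compares the values of h on words
    ending in aw for the various letters a, and the edges awb of the extension
    graph of w are what relates them. In topological terms, the Rauzy graph of
    order n + 1 is that of order n with each vertex w replaced by the graph
    G(w); replacing points by trees does not change the fundamental group, and
    the Rauzy graph of order 0 is a bouquet of circles labelled by A.

    Generation uses connectedness. Let K be the subgroup generated by R, and
    send a word u = pxs to the coset Ks. This coset does not depend on the
    chosen occurrence of x, because two occurrences of x in a word of F are
    separated by a product of return words. Appending a letter b to u multiplies
    the coset by b; hence, for an edge awb, the cosets at aw and at wb determine
    each other, and connectedness of G(w) makes the coset at aw independent of a
    ([determined_all]). After the descent the coset is constant, so that some
    conjugate of K is stable under multiplication by every letter, and K is
    everything ([first_returns_generate]).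

    Freeness uses acyclicity. Given a group H and f : R -> H, one needs
    phi : A -> H whose extension to words agrees with f on R. Let c(u, b) be
    f(r) if ub ends in xr for a (unique) return word r, and 1 otherwise; the
    product of c along the letters of r, read after px, is f(r). Since G(w) has
    no cycle, a function on its edges is of the form k(a)^-1 l(b)
    ([tree_potential], [ext_potential]), and therefore c can be replaced by a
    cohomologous cocycle that depends on one letter less ([gauge_step]). After
    the descent c has become a function phi of b alone ([gauge]). The gauge
    transformations can be chosen constant on the words that end in x, so that
    the product along r is still f(r) up to conjugation
    ([first_returns_free]). Taking for H the free group on R gives the left
    inverse. *)

(** * Words and generators of the free group *)

Lemma cat_eq_suffix (T : eqType) (p q u v : seq T) :
  p ++ u = q ++ v -> size v <= size u -> exists2 t, u = t ++ v & q = p ++ t.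
Proof.
elim: p q => [|a p IH] [|b q] /=.
- by move=> -> _; exists [::].
- by move=> -> _; exists (b :: q).
- by move=> <-; rewrite /= size_cat ltnNge leq_addl.
- by move=> [-> /IH/[apply]] [t -> ->]; exists t.
Qed.

Lemma nuniq_split (T : eqType) (s : seq T) : ~~ uniq s ->
  exists s1 v s2 s3, s = s1 ++ v :: s2 ++ v :: s3.
Proof.
elim: s => //= a s IH; rewrite negb_and negbK => /orP[as_|/IH].
  by case/splitPr: as_ => s2 s3; exists [::], a, s2, s3.
by case=> s1 [v [s2 [s3 ->]]]; exists (a :: s1), v, s2, s3.
Qed.

Section FreeGroup.
Variable T : choiceType.

Lemma fg_lift_fg_gen : fg_lift (@fg_gen T) =1 id.
Proof.
move=> g; have rg : reduced (fgval g) := valP g.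
apply: val_inj; rewrite /= -[RHS](reduce_id rg) {rg} /fg_lift.
elim: (fgval g) => [|[a []] w IH]; first by rewrite big_nil.
all: by rewrite big_cons /= IH /= (reduce_id (reduced_reduce w)).
Qed.

Lemma fg_gen_ind (K : set (freegroup T)) :
    K 1 -> (forall g h, K g -> K h -> K (g * h)) -> (forall g, K g -> K g^-1) ->
  (forall a, K (fg_gen a)) -> forall g, K g.
Proof.
move=> K1 KM KV KT g; rewrite -(fg_lift_fg_gen g) /fg_lift.
by apply: big_ind => // -[a []] _ /=; [|apply: KV]; apply: KT.
Qed.

End FreeGroup.

(** * Potentials on trees *)

Section Potential.
Variables (V : eqType) (e : rel V) (H : groupType) (k : V -> V -> H).

Fixpoint holonomy u p : H :=
  if p is v :: p' then k u v * holonomy v p' else 1.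

Lemma holonomy_cat u p q :
  holonomy u (p ++ q) = holonomy u p * holonomy (last u p) q.
Proof. by elim: p u => [|v p IH] u /=; rewrite ?mul1g // IH mulgA. Qed.

Hypothesis e_irr : irreflexive e.
Hypothesis kV : forall u v, e u v -> k v u = (k u v)^-1.

(** A closed walk in an acyclic graph which is not trivial visits some vertex
    twice, and cutting there yields two shorter closed walks. *)
Lemma holonomy_closed u p : graph_acyclic e ->
  path e u p -> last u p = u -> holonomy u p = 1.
Proof.
move=> acyc; have [n] := ubnP (size p).
elim: n p u => // n IH p u /ltnSE lepn ep lp.
have [uniq_p|/nuniq_split[s1 [v [s2 [s3 def_p]]]]] := boolP (uniq p).
  have /acyc : ucycle e p by rewrite /ucycle (cycle_path u) lp ep uniq_p.
  case: p ep lp {lepn uniq_p} => [|v [|w [|//]]] //=.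
    by move=> + eq_v; rewrite eq_v e_irr.
  by case/and3P=> uv _ _ eq_w _; rewrite eq_w (kV uv) mulg1 mulgV.
(* The walk s2 then v is the inner closed walk. *)
have defp' : p = rcons s1 v ++ rcons s2 v ++ s3.
  by rewrite def_p -!cats1 -!catA.
move: ep lp lepn; rewrite defp' !cat_path !holonomy_cat !last_cat !last_rcons.
rewrite !size_cat !size_rcons => /and3P[e1 e2 e3] l3 le_n.
rewrite (IH (rcons s2 v) v) //; first last.
- by rewrite last_rcons.
- rewrite size_rcons; apply: leq_trans le_n.
  by rewrite addSn ltnS addnCA leq_addr.
rewrite mul1g; have := holonomy_cat u (rcons s1 v) s3; rewrite last_rcons => <-.
apply: IH.
- rewrite size_cat size_rcons; apply: leq_trans le_n.
  by rewrite ltn_add2l addSn ltnS leq_addl.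
- by rewrite cat_path e1 last_rcons.
- by rewrite last_cat last_rcons.
Qed.

(** The potential of v is the holonomy of a path from a fixed root to v. It
    does not matter which path is chosen: two paths with the same ends are
    compared by closing both with the same path back. *)
Lemma tree_potential : is_tree e ->
  exists f : V -> H, forall u v, e u v -> k u v = (f u)^-1 * f v.
Proof.
case=> conn acyc; have [[u0 _]|noV] := pselect (exists u : V, True); last first.
  by exists (fun=> 1) => u; case: noV; exists u.
have /choice[P HP] v : exists p, path e u0 p /\ v = last u0 p.
  by have [p ep ->] := conn u0 v; exists p.
exists (fun v => holonomy u0 (P v)) => u v uv.
have [q eq_ lq] := conn v u0; have [[eu lu] [ev lv]] := (HP u, HP v).
have h1 : holonomy u0 (P u ++ v :: q) = 1.
  apply: (holonomy_closed acyc); last by rewrite last_cat.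
  by rewrite cat_path /= -lu eu uv.
have h2 : holonomy u0 (P v ++ q) = 1.
  apply: (holonomy_closed acyc); last by rewrite last_cat -lv.
  by rewrite cat_path -lv ev.
move: h1; rewrite -h2 !holonomy_cat /= -lu -lv mulgA => /mulIg <-.
by rewrite mulKg.
Qed.

End Potential.

(** * Extension graphs of a biessential set *)

Section Words.
Variables (A : choiceType) (F : set (seq A)).
Implicit Types (a b : A) (u v w x p q r s t z : seq A).

Hypothesis F_be : biessential F.

Lemma F_infix u p v s : u = p ++ v ++ s -> F u -> F v.
Proof. by move=> -> /F_be.1; apply; rewrite infix_infix. Qed.

Lemma F_pre u v : F (u ++ v) -> F u.
Proof. exact: (@F_infix _ [::]). Qed.

Lemma F_suf u v : F (u ++ v) -> F v.
Proof. by apply: (@F_infix _ u _ [::]); rewrite cats0. Qed.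

Lemma F_rcons u a : F (rcons u a) -> F u.
Proof. by rewrite -cats1; apply: F_pre. Qed.

(** Every word of F has arbitrarily long left extensions, so that nothing is
    lost by evaluating functions on long words only. *)
Lemma extend_left n w : F w -> exists2 p, size p = n & F (p ++ w).
Proof.
move=> Fw; elim: n => [|n [p sp /F_be.2[[a b] Fapwb]]]; first by exists [::].
exists (a :: p); first by rewrite /= sp.
by move: Fapwb; rewrite /Eext /= -rcons_cons; apply: F_rcons.
Qed.

Lemma ext_potential w (H : groupType) (k : A -> A -> H) :
  is_tree (@ext_edge A F w) ->
  exists f g : A -> H, forall a b, F (a :: rcons w b) -> k a b = (f a)^-1 * g b.
Proof.
pose kk (s t : ext_vertex F w) := match s, t with
  | inl a, inr b => k (val a) (val b)
  | inr b, inl a => (k (val a) (val b))^-1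
  | _, _ => 1 end.
case/(@tree_potential _ _ _ kk).
- by case.
- by case=> s [] t //= _; rewrite invgK.
move=> f Hf; exists (fun a => oapp (fun s : Lext F w => f (inl s)) 1 (insub a)).
exists (fun b => oapp (fun s : Rext F w => f (inr s)) 1 (insub b)) => a b Fawb.
have La : a \in Lext F w.
  by apply/mem_set/(@F_rcons _ b); rewrite rcons_cons.
have Rb : b \in Rext F w by apply/mem_set/(@F_suf [:: a]).
by rewrite !insubT /= -Hf //=; apply/mem_set.
Qed.

(** Along a path of the extension graph, the value of f is carried by the left
    vertices, and a right vertex b stands for the common value of f at its
    neighbours. *)
Lemma ext_connected w (T : Type) (f : A -> T) :
  graph_connected (@ext_edge A F w) ->
  (forall a a' b, F (a :: rcons w b) -> F (a' :: rcons w b) -> f a = f a') ->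
  forall a a', F (a :: w) -> F (a' :: w) -> f a = f a'.
Proof.
move=> conn Hf a a' Fa Fa'.
have La : a \in Lext F w by apply/mem_set.
have La' : a' \in Lext F w by apply/mem_set.
pose labelled y (v : ext_vertex F w) := match v with
  | inl c => f (val c) = y
  | inr b => forall c, F (c :: rcons w (val b)) -> f c = y end.
have labelledE y (u v : ext_vertex F w) :
    @ext_edge A F w u v -> labelled y u -> labelled y v.
  case: u v => u [] v //= /set_mem/= Fuv.
    by move=> <- c Fc; apply: Hf Fc Fuv.
  by apply.
have [p + lp] := conn (inl (exist _ a La)) (inl (exist _ a' La')).
suff: forall u : ext_vertex F w, path (@ext_edge A F w) u p ->
  labelled (f a) u -> labelled (f a) (last u p).
  by move=> HH /HH; rewrite -lp => /(_ erefl) ->.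
elim: p {lp} => //= v p IH u /andP[uv ep] lu.
by apply: IH ep _; apply: labelledE uv lu.
Qed.

(** * Functions determined by a suffix *)

(** The suffixes that suffice to know h are an arbitrary set Z, because they
    will be long ones as well as those that start with x. *)
Definition determined (T : Type) (D Z : set (seq A)) (h : seq A -> T) : Prop :=
  forall p p' z, Z z -> D (p ++ z) -> D (p' ++ z) -> h (p ++ z) = h (p' ++ z).

Lemma determined_value T (D Z : set (seq A)) (h : seq A -> T) :
  determined D Z h ->
  exists v : seq A -> T, forall p z, Z z -> D (p ++ z) -> h (p ++ z) = v z.
Proof.
move=> det; exists (fun z => h (xget [::] [set p | D (p ++ z)] ++ z)) => p z Zz Dz.
by apply: det => //; apply: (@xgetI _ _ [set p | D (p ++ z)] _ Dz).
Qed.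

(** Words too short to have n + 1 letters would obstruct the descent, which
    has to look at the letter that precedes a suffix of length n. *)
Definition long (D : set (seq A)) (n : nat) : set (seq A) :=
  [set u | D u /\ n <= size u].

(** The descent for connected extension graphs. For an edge awb, the value at
    aw is the inverse image by [act b] of the value at wb, which already is
    determined because wb has n + 1 letters; hence it is the same for all the
    left neighbours a of b, and then for all a. *)
Lemma determined_all N T (act : A -> T -> T) (h : seq A -> T) :
    (forall w, F w -> graph_connected (@ext_edge A F w)) ->
    (forall b, injective (act b)) ->
    (forall u b, F (rcons u b) -> N <= size u -> h (rcons u b) = act b (h u)) ->
  forall n, n <= N -> determined (long F N) [set z | n <= size z] h ->
  determined (long F N) setT h.
Proof.
move=> conn act_inj h_act; elim=> [_ det p p' z _|n IH ltnN det]; first exact: det.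
apply: (IH (ltnW ltnN)) => p p' z /= le_nz [Fp lep] [Fp' lep'].
have [lt_nz|le_zn] := ltnP n (size z); first exact: det.
have [v Hv] := determined_value det.
have ltzN : size z < N by apply: leq_ltn_trans ltnN.
have Hv' q a : F (q ++ a :: z) -> N <= size (q ++ a :: z) ->
    h (q ++ a :: z) = v (a :: z).
  by move=> Fq leq; apply: Hv.
move: Fp lep Fp' lep'; case/lastP: p => [|p a]; first by rewrite leqNgt ltzN.
case/lastP: p' => [|p' a']; first by move=> _ _ _; rewrite leqNgt ltzN.
rewrite !cat_rcons => Fp lep Fp' lep'; rewrite !Hv' //.
apply: (@ext_connected z _ (fun a => v (a :: z))).
- by apply: conn; apply: F_suf (_ : F (rcons p a ++ z)); rewrite cat_rcons.
- move=> c c' b Fc Fc'; apply: (act_inj b).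
  suff val_edge d : F (d :: rcons z b) -> act b (v (d :: z)) = v (rcons z b).
    by rewrite !val_edge.
  move=> Fd; have [q sq Fq] := extend_left N Fd.
  rewrite -rcons_cons -rcons_cat in Fq.
  have leNq : N <= size (q ++ d :: z) by rewrite size_cat sq leq_addr.
  rewrite -(Hv' q d (F_rcons Fq) leNq) -h_act //.
  rewrite !rcons_cat !rcons_cons in Fq *; rewrite -cat_rcons Hv //= ?size_rcons //.
  by split; rewrite cat_rcons // size_cat sq leq_addr.
- exact: F_suf Fp.
- exact: F_suf Fp'.
Qed.

(** * Gauge transformations of cocycles *)

Definition steps (b : A) : set (seq A) := [set u | F (rcons u b)].

Section Gauge.
Variables (H : groupType) (x : seq A) (N : nat).
Hypothesis tree : forall w, F w -> is_tree (@ext_edge A F w).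

(** Besides the last n letters, the functions of interest are at each stage
    determined by any suffix that starts with x. Keeping track of this second
    property is what controls the gauge transformation at the words ending
    in x. *)
Definition tails n : set (seq A) := [set z | n <= size z \/ prefix x z].

(** When w contains x, c does not depend on the letter a that precedes w, so
    that the left potential can be taken trivial. Otherwise the potential comes
    from the tree structure of the extension graph. *)
Lemma local_potential n (c : seq A -> A -> H) w :
  (forall b, determined (long (steps b) N) (tails n.+1) (c^~ b)) ->
  size w = n -> exists f : (A -> H) * (A -> H),
    (infix x w -> forall a, f.1 a = 1) /\
    forall p a b, long (steps b) N (p ++ a :: w) ->
      c (p ++ a :: w) b = (f.1 a)^-1 * f.2 b.
Proof.
move=> det sw; have /choice[v Hv] b := determined_value (det b).
have [/infixP[s [t def_w]]|xw] := boolP (infix x w).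
  exists (fun=> 1, fun b => v b (x ++ t)); split=> // p a b /=.
  have -> : p ++ a :: w = (p ++ a :: s) ++ (x ++ t) by rewrite def_w -catA.
  by rewrite invg1 mul1g; apply: Hv; right; rewrite prefix_prefix.
have [Fw|nFw] := pselect (F w); last first.
  exists (fun=> 1, fun=> 1); split=> // p a b [/= Fp _]; case: nFw.
  by apply: (@F_infix _ (rcons p a) _ [:: b]) Fp; rewrite cats1 cat_rcons rcons_cat.
have [f [g fg]] := ext_potential (fun a b => v b (a :: w)) (tree Fw).
exists (f, g); split=> // p a b Fp /=; rewrite Hv //=; last by left; rewrite /= sw.
apply: fg; case: Fp => /= Fp _.
by apply: (@F_suf p); rewrite -rcons_cons -rcons_cat.
Qed.

(** With c = k(a)^-1 l(b) on the edges awb, multiplying by the left potential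
    k(a) of w at the source removes the dependence on a. At the target, write
    wb = a'w'; the left potential of w' at a' only involves wb. The left
    potential only depends on xs at a word that ends in xs: if xs has more than
    n letters it contains aw, and otherwise w contains xs. *)
Lemma gauge_step n (c : seq A -> A -> H) :
  n < N -> (forall b, determined (long (steps b) N) (tails n.+1) (c^~ b)) ->
  exists g : seq A -> H, determined (long F N) (prefix x) g /\
  forall b, determined (long (steps b) N) (tails n)
              (fun u => g u * c u b * (g (rcons u b))^-1).
Proof.
move=> ltnN det.
have /choice[f Hf] w : exists f : (A -> H) * (A -> H), size w = n ->
    (infix x w -> forall a, f.1 a = 1) /\
    forall p a b, long (steps b) N (p ++ a :: w) ->
      c (p ++ a :: w) b = (f.1 a)^-1 * f.2 b.
  have [/(local_potential det)[f Hf]|] := eqVneq (size w) n; first by exists f.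
  by move/eqP => ne; exists (fun=> 1, fun=> 1).
pose g u := if drop (size u - n.+1) u is a :: w then (f w).1 a else 1.
have g_tail p z : n < size z -> g (p ++ z) = g z.
  move=> ltnz; rewrite /g size_cat drop_cat -addnBA // ltnNge leq_addr /=.
  by rewrite addKn.
have gE p a w : size w = n -> g (p ++ a :: w) = (f w).1 a.
  by move=> sw; rewrite g_tail /= ?sw // /g /= sw subnn.
have long_split p z : size z <= n -> n < size (p ++ z) ->
    exists q a t, p ++ z = q ++ a :: t ++ z /\ size (t ++ z) = n.
  move=> lezn lt; rewrite size_cat in lt.
  have lt' : n - size z < size p by rewrite -(ltn_add2r (size z)) subnK.
  have lt2 : size p - (n - size z).+1 < size p.
    by rewrite ltn_subrL (leq_trans _ lt').
  have [x0 _] : exists x0 : A, x0 \in p.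
    by case: p {lt lt2} lt' => // a p _; exists a; rewrite mem_head.
  set i := size p - (n - size z).+1 in lt2.
  exists (take i p), (nth x0 p i), (drop i.+1 p); split.
    by rewrite -cat_cons catA -drop_nth // cat_take_drop.
  by rewrite size_cat size_drop /i subnSK // subKn ?subnK // ltnW.
have g_x : determined (long F N) (prefix x) g.
  move=> p p' z xz [_ lep] [_ lep'].
  have [ltnz|lezn] := ltnP n (size z); first by rewrite !g_tail.
  (* The last n letters of q ++ z contain z, hence x. *)
  have g1 q : N <= size (q ++ z) -> g (q ++ z) = 1.
    move=> leq.
    have [q' [a [t [-> st]]]] := long_split q z lezn (leq_trans ltnN leq).
    rewrite gE //; apply: (Hf _ st).1.
    by case/prefixP: xz => s ->; apply/infixP; exists t, s.
  by rewrite !g1.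
exists g; split=> // b p p' z Zz Dp Dp'.
have [lt_zn|le_nz] := ltnP (size z) n.
  have xz : prefix x z by case: Zz => //; rewrite leqNgt lt_zn.
  have [[Fp lep] [Fp' lep']] := (Dp, Dp').
  rewrite (g_x p p') //; try by split=> //; apply: F_rcons; eassumption.
  rewrite (det b p p') //; last by right.
  congr (_ * (_)^-1); rewrite !rcons_cat; apply: g_x; rewrite -?rcons_cat.
  - by case/prefixP: xz => s ->; rewrite rcons_cat prefix_prefix.
  - by split; rewrite // size_rcons ltnW.
  - by split; rewrite // size_rcons ltnW.
pose w := drop (size z - n) z.
have sw : size w = n by rewrite size_drop subKn.
suff val_z q : long (steps b) N (q ++ z) ->
    g (q ++ z) * c (q ++ z) b * (g (rcons (q ++ z) b))^-1
    = (f w).2 b * (g (rcons w b))^-1.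
  by rewrite !val_z.
rewrite -(cat_take_drop (size z - n) z) -/w catA.
move: (q ++ _) => {}q Dq; have [_ leq] := Dq.
case/lastP: q Dq leq => [|q a] Dq leq; first by rewrite leqNgt /= sw ltnN in leq.
rewrite rcons_cat (g_tail _ (rcons w b)) ?size_rcons ?sw //.
rewrite cat_rcons in Dq *.
by rewrite gE // (Hf _ sw).2 // mulVKg.
Qed.

Lemma gauge n (c : seq A -> A -> H) : n <= N ->
  (forall b, determined (long (steps b) N) (tails n) (c^~ b)) ->
  exists G (phi : A -> H), determined (long F N) (prefix x) G /\
  forall u b, long (steps b) N u -> c u b = (G u)^-1 * phi b * G (rcons u b).
Proof.
elim: n c => [|n IH] c leN det.
  have /choice[v Hv] b := determined_value (det b).
  exists (fun=> 1), (fun b => v b [::]); split=> // u b Du.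
  by rewrite invg1 mul1g mulg1 -[u]cats0; apply: Hv; [left | rewrite cats0].
have [g [g_x det']] := gauge_step leN det.
have [G [phi [G_x HG]]] := IH _ (ltnW leN) det'.
exists (fun u => G u * g u), phi; split.
  move=> p p' z xz Dp Dp' /=; congr (_ * _); [exact: G_x | exact: g_x].
move=> u b Du; have /(canRL (mulgK _))/(canRL (mulKg _)) := HG u b Du.
by move=> ->; rewrite invgK invgM !mulgA.
Qed.

End Gauge.

(** * First right return words *)

Section ReturnWords.
Variable x : seq A.
Let R := first_right_return F x.

Lemma GammaP r : F (x ++ r) ->
  Gamma F x r <-> exists2 p, p <> [::] & x ++ r = p ++ x.
Proof.
move=> Fxr; split=> [[_ [_ [p p0 [_ -> <-]]]]|[p p0 def_xr]]; first by exists p.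
split; first exact: F_suf Fxr.
by split=> //; exists p => //; exists x.
Qed.

Lemma first_return_F r : R r -> F (x ++ r).
Proof. by case=> -[_ []]. Qed.

Lemma first_returnP r : R r -> exists2 p, p <> [::] & x ++ r = p ++ x.
Proof. by move=> Rr; apply/GammaP; [exact: first_return_F | case: Rr]. Qed.

(** x occurs in xr only as a prefix and as a suffix: the occurrence of x in
    the middle would make a proper prefix of r a return word. *)
Lemma first_return_overlap r q s :
  R r -> x ++ r = q ++ x ++ s -> q = [::] \/ s = [::].
Proof.
move=> Rr def_xr; case: q def_xr => [|a q] def_xr; [by left | right].
have le_s : size s <= size r.
  move/(congr1 size): (def_xr) => /eqP; rewrite !size_cat /= -(leq_add2l (size x)).
  by move=> /eqP ->; rewrite leq_addl.
have [|t def_r def_q] := @cat_eq_suffix _ x ((a :: q) ++ x) r s _ le_s.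
  by rewrite def_xr catA.
have [//|s0] := eqVneq s [::]; case: (Rr) => _ []; exists t.
  apply/GammaP; last by exists (a :: q).
  by apply: (@F_pre _ s); rewrite -catA -def_r; apply: first_return_F.
by exists s => //; apply/eqP.
Qed.

Lemma first_return_nil : ~ R [::].
Proof.
case/first_returnP => p p0; rewrite cats0 => /(congr1 size)/eqP.
by rewrite size_cat -[X in X == _]add0n eqn_add2r eq_sym size_eq0 => /eqP.
Qed.

Lemma first_return_prefix r s : R r -> R (r ++ s) -> s = [::].
Proof.
case/first_returnP=> p p0 def_xr Rrs.
have [|/p0[]|//] := @first_return_overlap _ p s Rrs.
by rewrite catA def_xr -catA.
Qed.

Lemma first_return_suffix_inj r r' w : R r -> R r' ->
  suffix (x ++ r) w -> suffix (x ++ r') w -> r = r'.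
Proof.
wlog le_r : r r' / size r <= size r'.
  by move=> W ? ? ? ?; have [/W|/ltnW/W] := leqP (size r) (size r');
    [apply | move=> ->].
move=> Rr Rr' /suffixP[p ->] /suffixP[p' /esym def_w].
have [|t def_xr' _] := cat_eq_suffix def_w; first by rewrite !size_cat leq_add2l.
have [t0|r0] := first_return_overlap Rr' def_xr'.
  by move: def_xr'; rewrite t0 /= => /eqP; rewrite eqseq_cat // eqxx => /eqP.
by case: first_return_nil; rewrite -r0.
Qed.

(** To recognise that a word has just completed a return to x, it is enough
    to read it from any occurrence of x that precedes its last letter. *)
Lemma first_return_suffix r p s b : R r ->
  suffix (x ++ r) (p ++ x ++ rcons s b) = suffix (x ++ r) (x ++ rcons s b).
Proof.
move=> Rr; apply/idP/idP=> /suffixP[q]; last first.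
  by move=> ->; apply/suffixP; exists (p ++ q); rewrite catA.
have [le_r|/ltnW le_s] := leqP (size (x ++ r)) (size (x ++ rcons s b)).
  by case/cat_eq_suffix=> // t -> _; apply/suffixP; exists t.
move/esym/cat_eq_suffix=> /(_ le_s)[t def_xr _].
have [t0|] := first_return_overlap Rr def_xr; last by case: (s).
by apply/suffixP; exists [::]; rewrite def_xr t0.
Qed.

Variable N : nat.
Hypothesis rec : forall z, F z -> N <= size z -> infix x z.

(** * Return words are free *)

Section Free.
Variables (H : groupType) (f : seq A -> H).

Definition return_cocycle u b : H :=
  xget 1 [set h | exists2 r, R r & suffix (x ++ r) (rcons u b) /\ h = f r].

Lemma return_cocycle_determined p s b :
  return_cocycle (p ++ x ++ s) b = return_cocycle (x ++ s) b.
Proof.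
congr xget; apply/funext=> h; apply/propext.
by split=> -[r Rr [sr ->]]; exists r => //; move: sr;
  rewrite !rcons_cat first_return_suffix.
Qed.

Lemma return_cocycle_last u b r : R r -> suffix (x ++ r) (rcons u b) ->
  return_cocycle u b = f r.
Proof.
move=> Rr sr; apply: xget_unique; first by exists r.
by move=> _ [r' Rr' [sr' ->]]; rewrite (first_return_suffix_inj Rr' Rr sr' sr).
Qed.

(** No return word is completed strictly inside a return word, since the set
    of first return words is a prefix code. *)
Lemma return_cocycle_inner t b s :
  R (t ++ b :: s) -> s <> [::] -> return_cocycle (x ++ t) b = 1.
Proof.
move=> Rr s0; apply: xgetPN => h [r Rr' [/suffixP[q def_q] _]].
have def_xr : x ++ t ++ b :: s = q ++ x ++ (r ++ s).
  by rewrite -cat_rcons 2!catA -rcons_cat def_q -!catA.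
have [q0|] := first_return_overlap Rr def_xr; last first.
  by case: (r) first_return_nil Rr' s0; case: (s).
move: def_xr; rewrite q0 /= => /eqP; rewrite eqseq_cat // eqxx /= => /eqP def_r.
by rewrite def_r in Rr; apply: s0; apply: first_return_prefix Rr' Rr.
Qed.

Fixpoint cocycle_prod (c : seq A -> A -> H) u s : H :=
  if s is b :: s' then c u b * cocycle_prod c (rcons u b) s' else 1.

Lemma return_cocycle_prod p r : R r ->
  cocycle_prod return_cocycle (p ++ x) r = f r.
Proof.
move=> Rr; suff prod_tail s t : t ++ s = r -> s <> [::] ->
    cocycle_prod return_cocycle (p ++ x ++ t) s = f r.
  rewrite -[x]cats0; apply: prod_tail => // r0.
  by case: first_return_nil; rewrite -r0.
elim: s t => // b s IH t def_r _ /=.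
have [s0|/eqP s0] := eqVneq s [::].
  rewrite s0 mulg1; apply: return_cocycle_last => //; apply/suffixP; exists p.
  by rewrite !rcons_cat -cats1 -s0 def_r.
rewrite return_cocycle_determined (@return_cocycle_inner _ _ s) ?def_r // mul1g.
by rewrite !rcons_cat; apply: IH; rewrite ?cat_rcons.
Qed.

(** The gauge factors telescope. *)
Lemma cocycle_prod_gauge (c : seq A -> A -> H) G phi u s :
  (forall u b, long (steps b) N u -> c u b = (G u)^-1 * phi b * G (rcons u b)) ->
  F (u ++ s) -> N <= size u ->
  cocycle_prod c u s = (G u)^-1 * (\prod_(b <- s) phi b) * G (u ++ s).
Proof.
move=> HG; elim: s u => [|b s IH] u /=.
  by rewrite cats0 big_nil mulg1 mulVg.
rewrite -cat_rcons => Fus leu; have leub : N <= size (rcons u b).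
  by rewrite size_rcons; apply: leqW.
rewrite big_cons (IH _ Fus leub).
rewrite HG; last by split=> //; apply: F_pre Fus.
by rewrite !mulgA mulgK.
Qed.

(** [gauge] yields phi up to conjugation by the value that G takes at all
    the long words ending in x. *)
Lemma first_returns_free : (forall w, F w -> is_tree (@ext_edge A F w)) ->
  exists phi : A -> H, forall r, R r -> \prod_(b <- r) phi b = f r.
Proof.
move=> tree.
have [|G [phi [G_x HG]]] :=
  gauge tree (leqnn N) (c := return_cocycle) (x := x).
  move=> b p p' z Zz Dp _; have : infix x z.
    case: Zz => [lez|/prefixP[s ->]]; last by rewrite prefix_infix // prefix_prefix.
    by apply: rec lez; apply: (@F_suf p); apply: (@F_rcons _ b); case: Dp.
  by case/infixP=> q [s ->]; rewrite !catA -!(catA _ x) !return_cocycle_determined.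
have [gam Hgam] : exists gam, forall p, long F N (p ++ x) -> G (p ++ x) = gam.
  have [v Hv] := determined_value G_x.
  by exists (v x) => p; apply: Hv; rewrite /= prefix_refl.
exists (fun b => gam^-1 * phi b * gam) => r Rr.
have -> : \prod_(b <- r) (gam^-1 * phi b * gam) =
    gam^-1 * (\prod_(b <- r) phi b) * gam.
  rewrite -[RHS]mulgA -conjgE conjg_prod; apply: eq_bigr => b _.
  by rewrite conjgE mulgA.
have [p sp Fp] := extend_left N (first_return_F Rr).
have [q _ def_xr] := first_returnP Rr.
have lep : N <= size (p ++ x) by rewrite size_cat sp leq_addr.
have Fpx : F (p ++ x) by apply: (@F_pre _ r); rewrite -catA.
rewrite -(return_cocycle_prod p Rr) (cocycle_prod_gauge HG) -?catA //.
rewrite [in RHS]def_xr [in RHS](catA p) !Hgam //.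
by split; rewrite -catA -def_xr // size_cat sp leq_addr.
Qed.

End Free.

(** * Return words generate *)

Section Generate.
Variable K : set (freegroup A).
Hypotheses (K1 : K 1) (KM : forall g h, K g -> K h -> K (g * h)).
Hypotheses (KV : forall g, K g -> K g^-1).
Hypothesis KR : forall r, R r -> K (fg_word r).

Lemma fg_word_cat u v : fg_word (u ++ v) = fg_word u * fg_word v.
Proof. exact: big_cat. Qed.

(** A word that leads from x back to x factors into first return words, at
    the successive occurrences of x. *)
Lemma return_subgroup s q : F (x ++ s) -> x ++ s = q ++ x -> K (fg_word s).
Proof.
have [n] := ubnP (size s); elim: n s q => // n IH s q /ltnSE les Fxs def_xs.
have [q0|/eqP q0] := eqVneq q [::].
  move: def_xs; rewrite q0 -[RHS]cats0 => /eqP; rewrite eqseq_cat // eqxx.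
  by move=> /eqP ->; rewrite /fg_word big_nil.
have [Rs|nRs] := pselect (R s); first exact: KR.
have : concat (Gamma F x) (@word_plus A) s.
  by apply: contrapT => ncat; apply: nRs; split=> //; apply/GammaP => //; exists q.
case=> g Gg [v v0 def_s].
have Fxg : F (x ++ g) by case: Gg => _ [].
have [p p0 def_xg] := (GammaP Fxg).1 Gg.
have sz : size g = size p.
  by move/(congr1 size): def_xg => /eqP; rewrite !size_cat addnC eqn_add2r => /eqP.
have ltg : 0 < size g by rewrite sz lt0n size_eq0; apply/eqP.
have ltv : 0 < size v by rewrite lt0n size_eq0; exact: (introN eqP v0).
move: les Fxs def_xs; rewrite -def_s size_cat => les Fxs def_xs.
rewrite fg_word_cat; apply: KM.
  by apply: (IH _ p) => //; apply: leq_trans les; rewrite -addn1 leq_add2l.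
have [||t def_xv _] := @cat_eq_suffix _ p q (x ++ v) x.
- by rewrite catA -def_xg -catA.
- by rewrite size_cat leq_addr.
apply: (IH _ t) => //; first by apply: leq_trans les; rewrite -add1n leq_add2r.
by apply: (@F_suf p); rewrite catA -def_xg -catA.
Qed.

Definition coset_word s : set (freegroup A) := [set g | K (g * (fg_word s)^-1)].

Lemma coset_word_eq s s' :
  K (fg_word s * (fg_word s')^-1) -> coset_word s = coset_word s'.
Proof.
move=> Kss; apply/funext=> g; apply/propext; split=> /= [Kg|Kg].
  by have := KM Kg Kss; rewrite mulgA mulgVK.
by have := KM Kg (KV Kss); rewrite invgM invgK mulgA mulgVK.
Qed.

Definition coset_shift b (C : set (freegroup A)) : set (freegroup A) :=
  [set g | C (g * (fg_gen b)^-1)].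

Lemma coset_shift_inj b : injective (coset_shift b).
Proof.
move=> C C' eqC; apply/funext=> g.
by have := congr1 (fun D => D (g * fg_gen b)) eqC; rewrite /coset_shift /= mulgK.
Qed.

Lemma coset_word_rcons s b :
  coset_word (rcons s b) = coset_shift b (coset_word s).
Proof.
apply/funext=> g; rewrite /coset_word /coset_shift /= -cats1 fg_word_cat.
by rewrite {2}/fg_word big_seq1 invgM mulgA.
Qed.

(** The occurrence of x is an arbitrary one; [coset_afterE] shows that the
    coset does not depend on it. *)
Definition coset_after u :=
  coset_word (xget [::] [set s | suffix (x ++ s) u]).

Lemma coset_afterE p s : F (p ++ x ++ s) ->
  coset_after (p ++ x ++ s) = coset_word s.
Proof.
move=> Fu; rewrite /coset_after; set s' := xget _ _.
have : suffix (x ++ s') (p ++ x ++ s).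
  by apply: (@xgetI _ _ [set s | suffix (x ++ s) _] s); apply: suffix_suffix.
case/suffixP=> p' def_u; move: {s'}(s') def_u => s' def_u.
have Kle q q' t t' : F (q ++ x ++ t) -> q ++ x ++ t = q' ++ x ++ t' ->
    size t' <= size t -> coset_word t = coset_word t'.
  rewrite !(catA _ x) => Ft eq_t let'.
  have [d def_t def_q] := cat_eq_suffix eq_t let'.
  move: def_q; rewrite -catA => /esym /cat_eq_suffix[|e def_x _].
    by rewrite size_cat leq_addr.
  apply: coset_word_eq; rewrite def_t fg_word_cat mulgK.
  apply: return_subgroup def_x; apply: (@F_infix _ q _ t') Ft.
  by rewrite def_t !catA.
have [le_s|/ltnW le_s] := leqP (size s) (size s').
  by apply: (Kle p' p); rewrite -?def_u.
by apply/esym/(Kle p p').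
Qed.

(** After the descent, [coset_after] is constant on long words. Its value is
    the coset of some g0, and its invariance under the shifts says that g0
    conjugates every letter into K. *)
Lemma first_returns_generate :
  (forall w, F w -> graph_connected (@ext_edge A F w)) ->
  (forall a, F [:: a]) -> F x -> forall g, K g.
Proof.
move=> conn F_A Fx.
have recE u : F u -> N <= size u -> exists p s, u = p ++ x ++ s.
  by move=> Fu leu; apply/infixP; apply: rec.
have det0 : determined (long F N) [set z | N <= size z] coset_after.
  move=> p p' z /= lez [Fp _] [Fp' _]; have [q [s def_z]] := recE z (F_suf Fp) lez.
  by move: Fp Fp'; rewrite def_z !(catA _ q) => Fp Fp'; rewrite !coset_afterE.
have shift u b : F (rcons u b) -> N <= size u ->
    coset_after (rcons u b) = coset_shift b (coset_after u).
  move=> Fub leu; have Fu := F_rcons Fub; have [p [s def_u]] := recE u Fu leu.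
  move: Fub Fu; rewrite def_u !rcons_cat => Fub Fu.
  by rewrite !coset_afterE // coset_word_rcons.
have det := determined_all conn coset_shift_inj shift (leqnn N) det0.
have afterE u v : long F N u -> long F N v -> coset_after u = coset_after v.
  by move=> Du Dv; rewrite -[u]cats0 -[v]cats0; apply: det; rewrite ?cats0.
have [p0 sp0 Fp0] := extend_left N Fx.
have {sp0 Fp0} Dp0 : long F N (p0 ++ x) by split; rewrite // size_cat sp0 leq_addr.
have [s0 def_C] : exists s0, coset_after (p0 ++ x) = coset_word s0.
  by exists [::]; rewrite -[X in p0 ++ X]cats0 coset_afterE // cats0; case: Dp0.
set g0 := fg_word s0.
have stab b : coset_shift b (coset_word s0) = coset_word s0.
  have [p sp Fpb] := extend_left N (F_A b); rewrite cats1 in Fpb.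
  have Dp : long F N p by split; [exact: F_rcons Fpb | rewrite sp].
  have Dpb : long F N (rcons p b) by split; rewrite // size_rcons sp.
  by rewrite -def_C (afterE _ _ Dp0 Dp) -shift ?sp // (afterE _ _ Dpb Dp).
have conj_gen b : K (g0 * fg_gen b * g0^-1).
  have /= : coset_word s0 g0 by rewrite /coset_word /= mulgV.
  by rewrite -(stab b) => /KV; rewrite !invgM !invgK mulgA.
move=> g; suff : K ((g ^ g0) ^ g0^-1) by rewrite conjgK.
by apply: (fg_gen_ind (K := [set h | K (h ^ g0^-1)])) => /=
  [|h k Kh Kk|h Kh|b]; rewrite ?conj1g ?conjMg ?conjVg //;
  [exact: KM | exact: KV | rewrite conjgE invgK mulgA].
Qed.

End Generate.
End ReturnWords.
End Words.

Theorem theorem7 (A : finType) (F : set (seq A)) (cardA : #|A| = 3)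
    (F_ur : uniformly_recurrent F) (F_A : forall a : A, F [:: a])
    (F_tree : tree_set F) (x : seq A) (Fx : F x) :
  is_basis [set fg_word r | r in first_right_return F x].
Proof.
have [F_be tree] := F_tree.
have [n _ recn] := F_ur.2 x Fx.
have rec z : F z -> n <= size z -> infix x z.
  move=> Fz len; apply: (@infix_trans _ (take n z)); last exact: infix_take.
  apply: recn; last by rewrite size_takel.
  by apply: (@F_pre _ _ F_be _ (drop n z)); rewrite cat_take_drop.
set X := [set fg_word r | r in first_right_return F x].
pose L := fg_lift (fun y : X => val y : freegroup A).
have L1 : L 1 = 1 by exact: gmulf1.
have LM g h : L (g * h) = L g * L h by exact: gmulfM.
have LV g : L g^-1 = (L g)^-1 by exact: gmulfV.
have LX (y : X) : L (fg_gen y) = val y by rewrite /L fg_lift_gen.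
have [phi Hphi] := first_returns_free F_be rec
  (fun r => oapp (fun y : X => fg_gen y) 1 (insub (fg_word r))) tree.
have phiL : cancel L (fg_lift phi).
  apply: (fg_gen_ind (K := [set h | fg_lift phi (L h) = h])) => /=.
  - by rewrite L1 fg_lift1.
  - by move=> g h; rewrite LM fg_liftM => -> ->.
  - by move=> g phiLg; rewrite LV -[in RHS]phiLg; apply: gmulfV.
  move=> y; rewrite LX; have [r Rr def_y] := set_mem (valP y).
  rewrite -def_y (gmulf_prod (fg_lift phi)) /=.
  under eq_bigr do rewrite fg_lift_gen.
  by rewrite Hphi // def_y valK.
exists (fg_lift phi) => // g.
suff [h <-] : exists h, L h = g by rewrite phiL.
move: g; apply: (first_returns_generate F_be rec (x := x)
  (K := [set g | exists h, L h = g])) => //=.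
- by exists 1.
- by move=> _ _ [g <-] [h <-]; exists (g * h).
- by move=> _ [g <-]; exists g^-1.
- move=> r Rr; have Xr : fg_word r \in X by apply/mem_set; exists r.
  by exists (fg_gen (exist (fun g => g \in X) _ Xr)); rewrite LX.
- by move=> w Fw; case: (tree w Fw).
Qed.
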